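(* Let $\mathcal{U}$ be a soft $\mathrm{UPE}(D{:}R|Z;E)$ for $\mathcal{H}$, let $\sigma$ be a positive integer, $\epsilon>0$, and let $\mathcal{E}$ be a strong extractor. Then the banked-randomness protocol $\mathcal{P}(\sigma,\epsilon;\mathcal{U})$ described in the context is a $(\sigma,\epsilon)$-sound and complete randomness generation protocol with respect to $\mathcal{H}$; completeness here means that it succeeds ($\mathcal{P}_P=1$) with probability $1$. Soundness is with respect to $E'=E$ in the case where the distribution of $Z$ is known and independent of $E$ (so that $Z$ is part of the output $\mathcal{P}_S$), and with respect to $E'=ZE$ otherwise.
   Context: All random variables (RVs) have finite value spaces; $\mathrm{Rng}(X)$ is the value space of $X$. Juxtaposition denotes joint RVs and values, and concatenation of strings. $R,Z,E$ are RVs, $D$ is a function of $R$, and $\mathcal{H}$ is a set (model) of joint distributions of $R,Z,E$. $\mu[X|\phi]$ is the distribution of $X$ conditional on $\phi$; conditions involving conditional probabilities are only required for conditioning values of positive probability. $\mathrm{TV}(\nu,\nu')=\frac12\sum_x|\nu(x)-\nu'(x)|$; $\mathrm{Unif}_X$ is uniform on $\mathrm{Rng}(X)$. A subprobability distribution is a non-negative function $\tilde\nu$ with weight $w(\tilde\nu)=\sum_x\tilde\nu(x)\le 1$. Soft UPE (soft uniform probability estimator): for $0\le\epsilon'\le1$, a function $F:\mathrm{Rng}(RZ)\to[0,\infty)$ is an $\epsilon'$-soft $\mathrm{UPE}(D{:}R|Z;E,\mathcal{H})$ if for all values $e$ of $E$ and all $\mu\in\mathcal{H}$: (1) there exist subprobability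 distributions $\tilde\mu_z\le\mu[DR|ze]$ of $DR$ with $\sum_z w(\tilde\mu_z)\mu(z|e)\ge 1-\epsilon'$; (2) there exists a non-negative function $q(r|dz)$ with $\sum_r q(r|dz)=1$ for all $dz$, such that $\tilde\mu_z(dr)\le F(rz)\,q(r|dz)$ for all $d,r,z$. A function $\mathcal{U}:\mathrm{Rng}(RZ)\times[0,1]\to[0,\infty)$ is a soft UPE if it is monotone non-decreasing in the second argument and for each $\epsilon'$, $\mathcal{U}(RZ,1-\epsilon')$ is an $\epsilon'$-soft UPE. Strong extractor: a family of functions $\mathcal{E}(\cdot,\cdot;\sigma_h,\sigma,\epsilon_x):\{0,1\}^m\times\{0,1\}^l\to\{0,1\}^\sigma$ together with a set of admissible parameter tuples $(m,l,\sigma_h,\sigma,\epsilon_x)$ (those that ''satisfy the extractor constraints''; these always include $\sigma_h\le m$, $1\le\sigma\le\sigma_h$, $0<\epsilon_x\le1$), such that for each admissible tuple, if $D'$ is any $m$-bit RV with $\max_{d'}\mathbb{P}(D'=d')\le2^{-\sigma_h}$ and $S$ is a uniform $l$-bit string independent of $D'$, then the joint distribution of $\mathcal{E}(D',S;\sigma_h,\sigma,\epsilon_x)S$ is within TV distance $\epsilon_x$ of uniform. Available randomness: sources of uniform random bits $S$ (seed) and $S_b$ (banked), independent of each other and of all other RVs. $(s)_{\le l}$ denotes the length-$l$ prefix. Protocol $\mathcal{P}(\sigma,\epsilon;\mathcal{U})$: (0) Choose (before and independently of $R,Z,S,S_b$) $n$, a positive integer $\sigma_h$, $\epsilon_h>0$,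 $\epsilon_x>0$ and $l$ such that $(n+\sigma_h,l,\sigma_h,\sigma,\epsilon_x)$ satisfies the extractor constraints and $\epsilon_h+\epsilon_x=\epsilon$. (1) Perform trials to obtain values $r,z$ of $R,Z$ expressed as bit strings, with $|D|=n$; let $d$ be the value of $D$. (2) Let $p=\mathcal{U}(rz,1-\epsilon_h)$ and $k=\max(0,\lceil\sigma_h-\log_2(1/p)\rceil)$. (3) Obtain values $(s)_{\le l}$ and $(s_b)_{\le k}$ of the prefixes $S_{\le l}$ and $(S_b)_{\le k}$. (4) Let $d'=d\,(s_b)_{\le k}\,0^{\sigma_h-k}$ (concatenation), where $0^{\sigma_h-k}$ is a string of zeros of length $\sigma_h-k$. (5) If the distribution of $Z$ is known and independent of $E$, let $z'=z$; otherwise let $z'$ be the empty string. (6) Output $\mathcal{P}_X=\mathcal{E}(d',(s)_{\le l};\sigma_h,\sigma,\epsilon_x)$, $\mathcal{P}_S=z'(s)_{\le l}$ and $\mathcal{P}_P=1$. Soundness: a protocol with outputs $\mathcal{P}_X$ (principal bit string), $\mathcal{P}_S$ (reusable random string), $\mathcal{P}_P\in\{0,1\}$ (success flag) is $(\sigma,\epsilon)$-sound with respect to $E'$ and $\mathcal{H}$ if for all $\mu\in\mathcal{H}$, $|\mathcal{P}_X|=\sigma$ and there is a distribution $\nu_{E'}$ of $E'$ such that $\mathrm{TV}(\mu[\mathcal{P}_X\mathcal{P}_SE'|\mathcal{P}_P=1],\mathrm{Unif}_{\mathcal{P}_X}\otimes\mu[\mathcal{P}_S]\otimes\nu_{E'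})\,\mathbb{P}_\mu(\mathcal{P}_P=1)\le\epsilon$.
   Formalization: The formal statement adds the assumption that k ≤ σ_h, i.e. p = U(rz,1−ε_h) ≤ 1, for all values rz of positive probability under some μ in H; otherwise the padding 0^{σ_h−k} has negative length and the protocol is undefined. *)

(* Defs.v *)
From mathcomp Require Export all_boot all_order all_algebra.
From mathcomp Require Export boolp classical_sets reals exp.

Set Implicit Arguments.
Unset Strict Implicit.
Unset Printing Implicit Defensive.

Import Order.TTheory GRing.Theory Num.Theory.

Local Open Scope ring_scope.

Record fdist (R : realType) (T : finType) := FDist {
  pmf :> T -> R;
  pmf_ge0 : forall x, 0 <= pmf x;
  pmf_sum1 : \sum_x pmf x = 1 }.

Section Probability.
Variable R : realType.

Definition TV (T : finType) (f g : T -> R) : R :=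
  2^-1 * \sum_x `|f x - g x|.

Definition unif (T : finType) (x : T) : R := #|T|%:R^-1.

Definition Pr (W : finType) (mu : fdist R W) (A : pred W) : R :=
  \sum_(w | A w) mu w.

Definition law (W T : finType) (mu : fdist R W) (X : W -> T) (x : T) : R :=
  Pr mu [pred w | X w == x].

(* The law of X conditional on the event A; meaningful if Pr mu A > 0. *)
Definition cond_law (W T : finType) (mu : fdist R W) (X : W -> T)
    (A : pred W) (x : T) : R :=
  Pr mu [pred w | (X w == x) && A w] / Pr mu A.

Definition weight (T : finType) (f : T -> R) : R := \sum_x f x.

Definition subprobability (T : finType) (f : T -> R) : Prop :=
  (forall x, 0 <= f x) /\ weight f <= 1.

Lemma unif_bits_ge0 n (x : n.-tuple bool) : 0 <= unif x.
Proof. by rewrite invr_ge0 ler0n. Qed.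

Lemma unif_bits_sum1 n : \sum_(x : n.-tuple bool) unif x = 1.
Proof.
rewrite /unif sumr_const -[LHS]mulr_natr cardT -cardE mulVf //.
by rewrite pnatr_eq0 card_tuple card_bool expn_eq0.
Qed.

Definition unif_bits n : fdist R (n.-tuple bool) :=
  FDist (@unif_bits_ge0 n) (unif_bits_sum1 n).

Lemma prodd_ge0 (A B : finType) (mu : fdist R A) (nu : fdist R B) (w : A * B) :
  0 <= mu w.1 * nu w.2.
Proof. by rewrite mulr_ge0 ?pmf_ge0. Qed.

Lemma prodd_sum1 (A B : finType) (mu : fdist R A) (nu : fdist R B) :
  \sum_(w : A * B) mu w.1 * nu w.2 = 1.
Proof.
rewrite -(pair_bigA _ (fun a b => mu a * nu b)) /= -[RHS](pmf_sum1 mu).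
by apply: eq_bigr => a _; rewrite -mulr_sumr pmf_sum1 mulr1.
Qed.

Definition prodd (A B : finType) (mu : fdist R A) (nu : fdist R B) :
  fdist R (A * B)%type := FDist (prodd_ge0 mu nu) (prodd_sum1 mu nu).

Definition log2 (x : R) : R := ln x / ln 2.

End Probability.

(* Models are sets of joint distributions of (R, Z, E), the random variables
   being the coordinates of RT * ZT * ET. *)
Section SoftUPE.
Variables (R : realType) (RT ZT ET DT : finType) (D : RT -> DT).

Definition rvR (w : RT * ZT * ET) : RT := w.1.1.
Definition rvZ (w : RT * ZT * ET) : ZT := w.1.2.
Definition rvE (w : RT * ZT * ET) : ET := w.2.
Definition rvDR (w : RT * ZT * ET) : DT * RT := (D (rvR w), rvR w).

Definition evZE z e : pred (RT * ZT * ET) :=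
  [pred w | (rvZ w == z) && (rvE w == e)].
Definition evE e : pred (RT * ZT * ET) := [pred w | rvE w == e].

(* mut z is the subprobability distribution attached to z, and q r d z stands
   for q(r|dz).  Conditions on z e are imposed only if z e has positive
   probability. *)
Definition is_soft_UPE_at (eps' : R) (H : set (fdist R (RT * ZT * ET)%type))
    (F : RT * ZT -> R) : Prop :=
  (forall rz, 0 <= F rz) /\
  forall (mu : fdist R (RT * ZT * ET)%type) (e : ET),
    H mu -> 0 < Pr mu (evE e) ->
    exists mut : ZT -> DT * RT -> R,
      (forall z, 0 < Pr mu (evZE z e) ->
        subprobability (mut z) /\
        forall x, mut z x <= cond_law mu rvDR (evZE z e) x) /\
      1 - eps' <= \sum_z weight (mut z) * cond_law mu rvZ (evE e) z /\
      exists q : RT -> DT -> ZT -> R,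
        (forall r d z, 0 <= q r d z) /\
        (forall d z, \sum_r q r d z = 1) /\
        (forall d r z, 0 < Pr mu (evZE z e) ->
          mut z (d, r) <= F (r, z) * q r d z).

(* The second argument of U ranges over [0, 1]; the values of U outside of
   this interval are unconstrained. *)
Definition is_soft_UPE (H : set (fdist R (RT * ZT * ET)%type))
    (U : RT * ZT -> R -> R) : Prop :=
  (forall rz a b, 0 <= a -> a <= b -> b <= 1 -> U rz a <= U rz b) /\
  forall eps', 0 <= eps' <= 1 ->
    is_soft_UPE_at eps' H (fun rz => U rz (1 - eps')).

(* All the members of the model have the same Z-marginal, under each of them
   Z is independent of E. *)
Definition known_independent_Z (H : set (fdist R (RT * ZT * ET)%type)) : Prop :=
  exists nuZ : fdist R ZT, forall mu : fdist R (RT * ZT * ET)%type, H mu ->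
    (forall z, law mu rvZ z = nuZ z) /\
    (forall z e, Pr mu (evZE z e) = law mu rvZ z * law mu rvE e).

End SoftUPE.

(* The arguments of ext and ext_adm are in the order m, l, sigma_h, sigma,
   eps_x.  The distribution of D' is nuD, and the seed is independent of it. *)
Record strong_extractor (R : realType) := StrongExtractor {
  ext : forall (m l sh sigma : nat) (epsx : R),
    m.-tuple bool -> l.-tuple bool -> sigma.-tuple bool;
  ext_adm : nat -> nat -> nat -> nat -> R -> Prop;
  ext_constraints : forall m l sh sigma epsx, ext_adm m l sh sigma epsx ->
    (sh <= m)%N /\ (0 < sigma <= sh)%N /\ 0 < epsx <= 1;
  ext_strong : forall m l sh sigma epsx, ext_adm m l sh sigma epsx ->
    forall nuD : fdist R (m.-tuple bool),
      (forall d', nuD d' <= 2 ^- sh) ->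
      TV (law (prodd nuD (unif_bits R l))
              (fun w => (ext sh sigma epsx w.1 w.2, w.2)))
         (@unif R (sigma.-tuple bool * l.-tuple bool)%type) <= epsx }.

(* |P_X| = sigma is enforced by the type of PX. *)
Definition sound (R : realType) (W TS TE : finType) (sigma : nat) (eps : R)
    (M : set (fdist R W)) (PX : W -> sigma.-tuple bool) (PS : W -> TS)
    (PP : W -> bool) (E' : W -> TE) : Prop :=
  forall mu : fdist R W, M mu ->
    exists nuE : fdist R TE,
      TV (cond_law mu (fun w => (PX w, PS w, E' w)) PP)
         (fun x => unif R x.1.1 * law mu PS x.1.2 * nuE x.2)
      * Pr mu PP <= eps.

Definition complete (R : realType) (W : finType) (M : set (fdist R W))
    (PP : W -> bool) : Prop :=
  forall mu : fdist R W, M mu -> Pr mu PP = 1.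

(* k = max(0, ceil(sh - log2(1/p))), where log2(1/0) = +oo. *)
Definition bank_len (R : realType) (sh : nat) (p : R) : nat :=
  if p == 0 then 0%N
  else absz (Num.max 0 (Num.ceil (sh%:R - log2 p^-1))).

Lemma bank_pad_subproof sh k (sb : sh.-tuple bool) :
  size (take k sb ++ nseq (sh - k) false) == sh.
Proof.
by rewrite size_cat size_take_min size_nseq size_tuple minnC minnE subnK ?leq_subr.
Qed.

(* (s_b)_{<=k} 0^{sh-k}; only used for k <= sh, see padding_ok. *)
Definition bank_pad sh k (sb : sh.-tuple bool) : sh.-tuple bool :=
  Tuple (bank_pad_subproof k sb).

Section Protocol.
Variables (R : realType) (RT ZT ET : finType).
Variable (H : set (fdist R (RT * ZT * ET)%type)).
Variables (n nz : nat) (D : RT -> n.-tuple bool) (encZ : ZT -> nz.-bseq bool).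
Variables (U : RT * ZT -> R -> R) (Ext : strong_extractor R).
Variables (sigma sh l : nat) (epsh epsx : R).

(* Trials, the l bits S_{<=l} of the seed, and the first sh bits of S_b, which
   are all that can be used. *)
Definition sample : finType :=
  (RT * ZT * ET * l.-tuple bool * sh.-tuple bool)%type.

Definition trial (w : sample) : RT * ZT * ET := w.1.1.
Definition seed (w : sample) : l.-tuple bool := w.1.2.
Definition bank (w : sample) : sh.-tuple bool := w.2.

Definition with_bits (mu : fdist R (RT * ZT * ET)%type) : fdist R sample :=
  prodd (prodd mu (unif_bits R l)) (unif_bits R sh).

Definition protocol_model : set (fdist R sample) :=
  [set mu' | exists2 mu, H mu & mu' = with_bits mu]%classic.

Definition protocol_k (t : RT * ZT * ET) : nat :=
  bank_len sh (U (rvR t, rvZ t) (1 - epsh)).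

(* The number sh - k of padding zeros is non-negative for all values that
   occur, that is, p <= 1.  Otherwise d' is not an (n + sh)-bit string. *)
Definition padding_ok : Prop :=
  forall mu : fdist R (RT * ZT * ET)%type, H mu ->
    forall t, 0 < mu t -> (protocol_k t <= sh)%N.

Definition protocol_d' (w : sample) : (n + sh).-tuple bool :=
  [tuple of D (rvR (trial w)) ++ bank_pad (protocol_k (trial w)) (bank w)].

Definition protocol_z' (w : sample) : nz.-bseq bool :=
  if `[< known_independent_Z H >] then encZ (rvZ (trial w)) else [bseq].

Definition protocol_X (w : sample) : sigma.-tuple bool :=
  ext Ext sh sigma epsx (protocol_d' w) (seed w).

Definition protocol_S (w : sample) : (nz + l).-bseq bool :=
  [bseq of protocol_z' w ++ bseq_of_tuple (seed w)].

Definition protocol_P (w : sample) : bool := true.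

Definition protocol_E (w : sample) : ET := rvE (trial w).

Definition protocol_ZE (w : sample) : ZT * ET :=
  (rvZ (trial w), rvE (trial w)).

End Protocol.

Arguments protocol_model {R RT ZT ET} H sh l.
Arguments protocol_X {R RT ZT ET n} D U Ext sigma sh l epsh epsx w.
Arguments protocol_S {R RT ZT ET} H {nz} encZ sh l w.
Arguments protocol_P {RT ZT ET sh l} w.
Arguments protocol_E {RT ZT ET sh l} w.
Arguments protocol_ZE {RT ZT ET sh l} w.

(* Main.v *)
(* Condition on Z = z and E = e.  Before padding, the subdistribution of (D, R)
   given by the soft UPE is at most p q(r|dz).  The k banked bits multiply this
   by 2^-k <= 2^-sh / p, so that summing over r leaves a subdistribution of D'
   bounded by 2^-sh, with the weight w_z of the original one.  Completed to a
   distribution with the same bound, it is a legitimate source for the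
   extractor, at distance at most 1 - w_z from the true law of D'.  Averaging
   1 - w_z + epsx over z and e gives that the joint law of P_X, the seed, Z and
   E is within epsh + epsx of ideal, and both claims follow by data processing.
   When epsh > 1 the soft UPE says nothing, but then TV <= 1 < eps. *)

Require Import Defs.
From mathcomp Require Import ring lra.

Set Implicit Arguments.
Unset Strict Implicit.
Unset Printing Implicit Defensive.

Import Order.TTheory GRing.Theory Num.Theory.
Local Open Scope ring_scope.

(** * Pushforwards and products of real-valued functions on finite types *)

(** On a distribution this is [law]; arbitrary functions are allowed so that subdistributions can be
    pushed forward too. *)
Definition push (R : realType) (W T : finType) (f : W -> R) (X : W -> T)
  (y : T) : R := \sum_(w | X w == y) f w.

Definition tens (R : realType) (A B : finType) (f : A -> R) (g : B -> R)
  (w : A * B) : R := f w.1 * g w.2.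

Lemma tensE (R : realType) (A B : finType) (f : A -> R) (g : B -> R) w :
  tens f g w = f w.1 * g w.2.
Proof. by []. Qed.

Lemma eq_push (R : realType) (W T : finType) (f g : W -> R) (X Y : W -> T) :
  f =1 g -> X =1 Y -> push f X =1 push g Y.
Proof.
by move=> fg XY y; apply: eq_big => [w|w _]; [rewrite XY | exact: fg].
Qed.

Lemma push_ge0 (R : realType) (W T : finType) (f : W -> R) (X : W -> T) y :
  (forall w, 0 <= f w) -> 0 <= push f X y.
Proof. by move=> f0; apply: sumr_ge0. Qed.

Lemma weight_push (R : realType) (W T : finType) (f : W -> R) (X : W -> T) :
  weight (push f X) = weight f.
Proof. by rewrite /weight (partition_big X xpredT). Qed.

Lemma push_comp (R : realType) (W T V : finType) (f : W -> R) (X : W -> T)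
    (Y : T -> V) :
  push (push f X) Y =1 push f (fun w => Y (X w)).
Proof.
move=> v; rewrite /push [RHS](partition_big X (fun y => Y y == v)) //=.
apply: eq_bigr => y /eqP Yy; apply: eq_bigl => w.
by case: (X w =P y) => [->|]; rewrite ?andbF // Yy eqxx.
Qed.

Lemma push_bij (R : realType) (W V T : finType) (f : W -> R) (X : W -> T)
    (h : V -> W) :
  bijective h -> push f X =1 push (fun v => f (h v)) (fun v => X (h v)).
Proof. by move=> bh y; rewrite /push (reindex h) //; exact: onW_bij. Qed.

Lemma push_tens (R : realType) (A B C D : finType) (f : A -> R) (g : B -> R)
    (X : A -> C) (Y : B -> D) :
  push (tens f g) (fun w => (X w.1, Y w.2)) =1 tens (push f X) (push g Y).
Proof.
case=> c d; rewrite /tens /push big_distrlr pair_big /=.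
by apply: eq_bigl => -[a b]; rewrite xpair_eqE.
Qed.

Lemma push_id (R : realType) (W : finType) (f : W -> R) : push f id =1 f.
Proof. by move=> w; rewrite /push big_pred1_eq. Qed.

Lemma push_fst (R : realType) (A B : finType) (f : A -> R) (g : B -> R) :
  weight g = 1 -> push (tens f g) fst =1 f.
Proof.
move=> g1 a; rewrite /push (eq_bigl (fun w => (w.1 == a) && true)); last first.
  by move=> w; rewrite andbT.
rewrite -(pair_big (pred1 a) xpredT (fun a b => f a * g b)) /= big_pred1_eq.
by rewrite -mulr_sumr [X in _ * X]g1 mulr1.
Qed.

Lemma push_snd (R : realType) (A B : finType) (f : A -> R) (g : B -> R) :
  weight f = 1 -> push (tens f g) snd =1 g.
Proof.
move=> f1 b; rewrite /push (eq_bigl (fun w => true && (w.2 == b))) //.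
rewrite -(pair_big xpredT (pred1 b) (fun a b => f a * g b)) /=.
under eq_bigr => a _ do rewrite big_pred1_eq.
by rewrite -mulr_suml [X in X * _]f1 mul1r.
Qed.

Lemma weight_tens (R : realType) (A B : finType) (f : A -> R) (g : B -> R) :
  weight (tens f g) = weight f * weight g.
Proof. by rewrite /weight /tens big_distrlr pair_bigA. Qed.

Section PushDist.
Variables (R : realType) (W T : finType) (mu : fdist R W) (X : W -> T).

Lemma push_fdist_sum1 : \sum_y push mu X y = 1.
Proof. by rewrite [LHS]weight_push; exact: pmf_sum1. Qed.

Definition push_fdist : fdist R T :=
  FDist (fun y => push_ge0 X y (pmf_ge0 mu)) push_fdist_sum1.
End PushDist.

Lemma unif_sum1 (R : realType) (T : finType) (x0 : T) :
  weight (@unif R T) = 1.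
Proof.
rewrite /weight /unif sumr_const -[LHS]mulr_natr mulVf // pnatr_eq0 -lt0n.
by apply/card_gt0P; exists x0.
Qed.

Lemma unif_tens (R : realType) (A B : finType) :
  @unif R (A * B)%type =1 tens (@unif R A) (@unif R B).
Proof. by case=> a b; rewrite /tens /unif card_prod natrM invfM. Qed.

(** * Total variation distance and bounded completions *)

Lemma eq_TV (R : realType) (T : finType) (f f' g g' : T -> R) :
  f =1 f' -> g =1 g' -> TV f g = TV f' g'.
Proof.
by move=> ff gg; congr (_ * _); apply: eq_bigr => x _; rewrite ff gg.
Qed.

Lemma TV_triangle (R : realType) (T : finType) (f g h : T -> R) :
  TV f h <= TV f g + TV g h.
Proof.
rewrite -mulrDr ler_wpM2l ?invr_ge0 ?ler0n // -big_split.
by apply: ler_sum => x _; exact: ler_distD.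
Qed.

(** Data processing: the triangle inequality within each fibre of [X]. *)
Lemma TV_push (R : realType) (W T : finType) (f g : W -> R) (X : W -> T) :
  TV (push f X) (push g X) <= TV f g.
Proof.
rewrite ler_wpM2l ?invr_ge0 ?ler0n //.
rewrite [leRHS](partition_big X xpredT) //=.
by apply: ler_sum => y _; rewrite -sumrB; exact: ler_norm_sum.
Qed.

Lemma TV_tensr (R : realType) (A B : finType) (f g : A -> R) (h : B -> R) :
  (forall b, 0 <= h b) -> weight h = 1 -> TV (tens f h) (tens g h) = TV f g.
Proof.
move=> h0 h1; congr (_ * _).
rewrite -(pair_bigA _ (fun a b => `|f a * h b - g a * h b|)).
apply: eq_bigr => a _.
under eq_bigr => b _ do rewrite -mulrBl normrM (ger0_norm (h0 b)).
by rewrite -mulr_sumr [X in _ * X]h1 mulr1.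
Qed.

Lemma TV_slices (R : realType) (A B C : finType) (f g : A * (B * C) -> R) :
  TV f g = \sum_c \sum_b TV (fun a => f (a, (b, c))) (fun a => g (a, (b, c))).
Proof.
rewrite exchange_big pair_bigA /TV -mulr_sumr exchange_big pair_bigA.
by congr (_ * _); apply: eq_bigr => -[a []].
Qed.

Lemma TV_scale (R : realType) (T : finType) (c : R) (f g : T -> R) :
  0 <= c -> TV (fun x => c * f x) (fun x => c * g x) = c * TV f g.
Proof.
move=> c0; rewrite /TV mulrCA; congr (_ * _); rewrite mulr_sumr.
by apply: eq_bigr => x _; rewrite -mulrBr normrM ger0_norm.
Qed.

(** Pointwise, |f - g| <= (f - h) + (g - h), and half the sum of the right side is 1 - weight h. *)
Lemma TV_minorant (R : realType) (T : finType) (f g h : T -> R) :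
  weight f = 1 -> weight g = 1 -> (forall x, h x <= f x) ->
  (forall x, h x <= g x) -> TV f g <= 1 - weight h.
Proof.
move=> f1 g1 hf hg.
have -> : 1 - weight h = 2^-1 * \sum_x ((f x - h x) + (g x - h x)).
  by rewrite big_split /= !sumrB; move: f1 g1; rewrite /weight => -> ->; lra.
rewrite ler_wpM2l ?invr_ge0 ?ler0n //; apply: ler_sum => x _.
by rewrite ler_norml; move: (hf x) (hg x) => *; apply/andP; split; lra.
Qed.

Lemma TV_le1 (R : realType) (T : finType) (f g : T -> R) :
  weight f = 1 -> weight g = 1 -> (forall x, 0 <= f x) ->
  (forall x, 0 <= g x) -> TV f g <= 1.
Proof.
move=> f1 g1 f0 g0.
suff -> : 1 = 1 - weight (fun _ : T => 0 : R) by exact: TV_minorant.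
by rewrite /weight big1 // subr0.
Qed.

(* Mix h with the constant function c. *)
Lemma bounded_completion (R : realType) (T : finType) (h : T -> R) (c : R) :
  (forall x, 0 <= h x <= c) -> weight h <= 1 -> 1 <= c * #|T|%:R ->
  exists nu : fdist R T, forall x, h x <= nu x <= c.
Proof.
move=> hc w1 cT; set w := weight h in w1 *; set C := c * #|T|%:R in cT.
(* Mixing in the proportion [t] lifts the weight from [w] to 1. If C = w, division by zero gives t =
   0, which is right: w <= 1 <= C then forces w = 1. *)
pose t := (1 - w) / (C - w).
have t01 : 0 <= t <= 1.
  rewrite /t divr_ge0 ?subr_ge0 ?(le_trans w1) //=.
  have [->|Cw] := eqVneq C w; first by rewrite subrr invr0 mulr0.
  rewrite ler_pdivrMr ?mul1r ?lerD2r // subr_gt0 lt_neqAle eq_sym Cw.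
  exact: le_trans w1 cT.
pose f x := h x + t * (c - h x).
have fP x : h x <= f x <= c.
  have /andP[h0 hxc] := hc x; have /andP[t0 t1] := t01.
  rewrite /f lerDl mulr_ge0 ?subr_ge0 //= -lerBrDl.
  by rewrite ler_piMl ?subr_ge0.
have f0 x : 0 <= f x.
  by have /andP[h0 _] := hc x; have /andP[+ _] := fP x; exact: le_trans.
have f1 : \sum_x f x = 1.
  have sumc : \sum_(x : T) c = C by rewrite sumr_const -[LHS]mulr_natr.
  rewrite big_split /= -mulr_sumr sumrB sumc -/(weight h) -/w.
  have [CwE|Cw] := eqVneq C w; last by rewrite divfK ?subr_eq0 // subrKC.
  by rewrite CwE subrr mulr0 addr0; apply/eqP; rewrite eq_le w1 -CwE cT.
by exists (FDist f0 f1).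
Qed.

(** * Extraction from a source that dominates a bounded subdistribution *)

(** The completion [nu] of [h] is a legitimate source, and [h] lies below both [P] and [nu], so
    exchanging them costs at most 1 - weight h. *)
Lemma strong_extractor_smooth (R : realType) (Ext : strong_extractor R)
    m l sh sigma epsx (P : fdist R (m.-tuple bool)) (h : m.-tuple bool -> R) :
  ext_adm Ext m l sh sigma epsx ->
  (forall x, 0 <= h x <= 2 ^- sh) -> (forall x, h x <= P x) ->
  TV (push (tens P (@unif R (l.-tuple bool)))
        (fun w => (ext Ext sh sigma epsx w.1 w.2, w.2)))
     (@unif R (sigma.-tuple bool * l.-tuple bool)%type)
  <= (1 - weight h) + epsx.
Proof.
move=> adm hc hP.
have [shm _] := ext_constraints adm.
have [||nu nuP] := bounded_completion hc.
- by rewrite -(pmf_sum1 P); apply: ler_sum.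
(* The completion needs 2^sh <= 2^m, which is the extractor constraint sh <= m. *)
- rewrite card_tuple card_bool natrX ler_pdivlMl ?exprn_gt0 ?mulr1 ?ltr0n //.
  by rewrite ler_eXn2l ?ltr1n.
have nuc x : nu x <= 2 ^- sh by have /andP[] := nuP x.
apply: le_trans (TV_triangle _ _ _) (lerD _ (ext_strong adm nuc)).
apply: le_trans (TV_push _ _ _) _.
rewrite TV_tensr; last 2 first.
- exact: unif_bits_ge0.
- exact: unif_bits_sum1.
apply: TV_minorant hP _; try exact: pmf_sum1.
by move=> x; have /andP[] := nuP x.
Qed.

(** * Banked bits: their mass and their number *)

(** Strings with the same padded image share their first [k] bits, so the remaining sh - k bits
    determine them: at most 2^(sh-k) of the 2^sh strings are counted. *)
Lemma bank_pad_prob (R : realType) sh k (b : sh.-tuple bool) : (k <= sh)%N ->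
  push (@unif R (sh.-tuple bool)) (bank_pad k) b <= 2 ^- k.
Proof.
move=> ksh; rewrite /push /unif sumr_const card_tuple card_bool.
have szd (s : sh.-tuple bool) : size (drop k s) == (sh - k)%N.
  by rewrite size_drop size_tuple.
pose f (s : sh.-tuple bool) := Tuple (szd s).
have inj : {in [pred s | bank_pad k s == b] &, injective f}.
  move=> s s'; rewrite !inE => /eqP sb /eqP s'b /(congr1 val) /= ds.
  apply: val_inj; rewrite /= -(cat_take_drop k s) -(cat_take_drop k s') ds.
  congr (_ ++ _); have /(congr1 (take k \o val)) := etrans sb (esym s'b).
  by rewrite /= !takel_cat ?size_takel ?size_tuple // !take_takel.
have := leq_card_in _ _ inj; rewrite card_tuple card_bool => le.
rewrite -[_ *+ _]mulr_natl ler_pdivrMr; last by rewrite ltr0n expn_gt0.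
have -> : (2 ^ sh)%:R = 2 ^+ k * (2 ^ (sh - k))%:R :> R.
  by rewrite -natrX -natrM -expnD subnKC.
by rewrite mulKf ?expf_neq0 ?pnatr_eq0 // ler_nat.
Qed.

(** The ceiling gives k >= sh + log2 p, which is the claim after taking logarithms. For p = 0 the
    left side vanishes. *)
Lemma bank_len_bound (R : realType) sh (p : R) : 0 <= p ->
  (bank_len sh p <= sh)%N -> p * 2 ^- bank_len sh p <= 2 ^- sh.
Proof.
rewrite /bank_len; have [->|p0 pge0 _] := eqVneq p 0.
  by move=> _ _; rewrite mul0r invr_ge0 exprn_ge0.
have {p0 pge0} p_gt0 : 0 < p by rewrite lt_def p0.
set k := absz _.
have ln2 : 0 < ln 2 :> R by rewrite ln_gt0 // ltr1n.
have /(ler_wpM2r (ltW ln2)) : sh%:R - log2 p^-1 <= k%:R.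
  apply: le_trans (ceil_ge _) _.
  rewrite -[leRHS]/((k%:Z)%:~R) ler_int /k gez0_abs le_max ?lexx //.
  by rewrite orbT.
rewrite /log2 mulrBl divfK ?gt_eqF // lnV // opprK => le.
rewrite ler_pdivrMr ?exprn_gt0 // ler_pdivlMl ?exprn_gt0 //.
rewrite -ler_ln ?posrE ?mulr_gt0 ?exprn_gt0 // lnM ?posrE ?exprn_gt0 //.
have lnX j : ln (2 ^+ j) = j%:R * ln 2 :> R by rewrite lnXn // mulr_natl.
by rewrite !lnX; lra.
Qed.

(** * The source string for fixed z and e *)

(** This is [protocol_d'] at a fixed z, with [F r] in the role of [U (r, z) (1 - epsh)]. Below,
    [rho] stands for the law of R given z and e, and [g] for the soft UPE subdistribution on the
    graph of [D]. *)
Definition padded (R : realType) (RT : finType) n sh (D : RT -> n.-tuple bool)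
    (F : RT -> R) (v : RT * sh.-tuple bool) : (n + sh).-tuple bool :=
  [tuple of D v.1 ++ bank_pad (bank_len sh (F v.1)) v.2].

Section Padded.
Variables (R : realType) (RT : finType) (n sh : nat) (D : RT -> n.-tuple bool).
Variables (F : RT -> R) (q : RT -> n.-tuple bool -> R).
Variables (rho : fdist R RT) (g : RT -> R).
Hypotheses (F_ge0 : forall r, 0 <= F r) (q_ge0 : forall r d, 0 <= q r d).
Hypothesis q_sum1 : forall d, \sum_r q r d = 1.
Hypotheses (g_ge0 : forall r, 0 <= g r) (g_le : forall r, g r <= rho r).
Hypothesis g_leF : forall r, g r <= F r * q r (D r).
Hypothesis pad_ok : forall r, 0 < rho r -> (bank_len sh (F r) <= sh)%N.

(** The string [x] fixes d and the padded block, although the number of banked bits still varies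
    with r. Each r with D r = d contributes at most 2^-sh q(r|d), and [q] sums to 1 over r. *)
Lemma padded_bound x :
  push (tens g (@unif R (sh.-tuple bool))) (padded D F) x <= 2 ^- sh.
Proof.
have c0 : 0 <= 2 ^- sh :> R by rewrite invr_ge0 exprn_ge0.
(* Outside the image the mass is zero; inside it, a preimage [v0] supplies the two halves of [x]. *)
have [v0 /eqP <-|none] := pickP (fun v => padded D F v == x); last first.
  by rewrite /push big_pred0.
set d0 := D v0.1; set b0 := bank_pad (bank_len sh (F v0.1)) v0.2.
have -> : push (tens g (@unif R _)) (padded D F) (padded D F v0) =
    \sum_(r | D r == d0)
      g r * push (@unif R _) (bank_pad (bank_len sh (F r))) b0.
  under [RHS]eq_bigr => r _ do rewrite mulr_sumr.
  rewrite pair_big_dep; apply: eq_bigl => v.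
  by rewrite -val_eqE /= eqseq_cat ?size_tuple.
apply: (@le_trans _ _ (\sum_r 2 ^- sh * q r d0)); last first.
  by rewrite -mulr_sumr q_sum1 mulr1.
rewrite big_mkcond; apply: ler_sum => r _.
have [Dr|_] := eqVneq (D r) d0; last exact: mulr_ge0.
(* Where [rho] vanishes [pad_ok] is silent, but [g] vanishes as well. *)
have [rho0|rho_neq0] := eqVneq (rho r) 0.
  have -> : g r = 0 by apply: le_anti; rewrite g_ge0 andbT -rho0.
  by rewrite mul0r mulr_ge0.
have k_le : (bank_len sh (F r) <= sh)%N.
  by apply: pad_ok; rewrite lt_def rho_neq0 pmf_ge0.
apply: le_trans (ler_wpM2l (g_ge0 r) (bank_pad_prob R b0 k_le)) _.
rewrite -Dr; apply: (@le_trans _ _ (F r * q r (D r) / 2 ^+ bank_len sh (F r))).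
  by rewrite ler_wpM2r ?invr_ge0 ?exprn_ge0.
by rewrite mulrAC ler_wpM2r // bank_len_bound.
Qed.

(** The minorant of the true source is [g] carried through banking and padding, which preserves both
    its weight and the domination by [rho]. *)
Lemma padded_extraction (Ext : strong_extractor R) l sigma epsx :
  ext_adm Ext (n + sh) l sh sigma epsx ->
  TV (push (tens (push (tens rho (@unif R (sh.-tuple bool))) (padded D F))
               (@unif R (l.-tuple bool)))
        (fun w => (ext Ext sh sigma epsx w.1 w.2, w.2)))
     (@unif R (sigma.-tuple bool * l.-tuple bool)%type)
  <= (1 - weight g) + epsx.
Proof.
move=> adm; have u0 := @unif_bits_ge0 R sh.
pose h := push (tens g (@unif R (sh.-tuple bool))) (padded D F).
have -> : weight g = weight h.
  by rewrite weight_push weight_tens [weight (@unif R _)]unif_bits_sum1 mulr1.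
apply: (strong_extractor_smooth
  (P := push_fdist (prodd rho (unif_bits R sh)) (padded D F))) => // x.
- by rewrite padded_bound andbT; apply: push_ge0 => v; exact: mulr_ge0.
- by apply: ler_sum => v _; rewrite ler_wpM2r.
Qed.

End Padded.

(** * The joint law of output, seed, Z and E *)

Section Joint.
Variables (R : realType) (RT ZT ET : finType).
Variable H : set (fdist R (RT * ZT * ET)%type).
Variables (n : nat) (D : RT -> n.-tuple bool).
Variables (U : RT * ZT -> R -> R) (Ext : strong_extractor R).
Variables (sigma sh l : nat) (epsh epsx : R).
Hypotheses (HU : is_soft_UPE D H U) (epsh_gt0 : 0 < epsh).
Hypothesis epsx_gt0 : 0 < epsx.
Hypothesis Hadm : ext_adm Ext (n + sh) l sh sigma epsx.
Hypothesis Hpad : padding_ok H U sh epsh.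

Definition ZE (t : RT * ZT * ET) : ZT * ET := (rvZ t, rvE t).

(** Grouped so that [TV_slices] fixes z and e and leaves the pair of output and seed to the
    extractor bound. *)
Definition XSZE (w : sample RT ZT ET sh l) :
    (sigma.-tuple bool * l.-tuple bool) * (ZT * ET) :=
  ((protocol_X D U Ext sigma sh l epsh epsx w, seed w), ZE (trial w)).

Notation unifXS := (@unif R (sigma.-tuple bool * l.-tuple bool)%type).

Lemma push_ZE (mu : fdist R (RT * ZT * ET)%type) z e :
  push mu ZE (z, e) = Pr mu (evZE z e).
Proof. by apply: eq_bigl => t; rewrite xpair_eqE. Qed.

Lemma Pr_evZE (mu : fdist R (RT * ZT * ET)%type) z e :
  Pr mu (evZE z e) = \sum_r mu ((r, z), e).
Proof.
rewrite /Pr (reindex_onto (fun r : RT => ((r, z), e)) (@rvR RT ZT ET)) /=.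
  by apply: eq_bigl => r; rewrite /evZE /= !eqxx.
by case=> [[r z'] e']; rewrite /evZE /rvZ /rvE /= => /andP[/eqP -> /eqP ->].
Qed.

Section Slice.
Variables (mu : fdist R (RT * ZT * ET)%type) (z : ZT) (e : ET).
Hypothesis m_gt0 : 0 < Pr mu (evZE z e).

Lemma cond_R_ge0 r : 0 <= mu ((r, z), e) / Pr mu (evZE z e).
Proof. by rewrite divr_ge0 ?pmf_ge0 // ltW. Qed.

Lemma cond_R_sum1 : \sum_r mu ((r, z), e) / Pr mu (evZE z e) = 1.
Proof. by rewrite -mulr_suml -Pr_evZE divff // gt_eqF. Qed.

Definition cond_R : fdist R RT := FDist cond_R_ge0 cond_R_sum1.

(** Since D is a function of R, the joint law lives on the graph of [D]. *)
Lemma cond_law_DR d r :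
  cond_law mu (rvDR D) (evZE z e) (d, r) = if D r == d then cond_R r else 0.
Proof.
rewrite /cond_law; have [<-|Dr] := eqVneq (D r) d; last first.
  rewrite /Pr big_pred0 ?mul0r // => t; apply/negP => /= /andP[].
  rewrite xpair_eqE => /andP[/eqP Dt /eqP tr] _.
  by rewrite -Dt tr eqxx in Dr.
rewrite /= /Pr; congr (_ / _).
rewrite (big_pred1 ((r, z), e)) // => -[[r' z'] e'] /=.
rewrite /evZE /= !xpair_eqE /rvR /rvZ /rvE /=.
by case: (r' =P r) => [->|]; rewrite ?eqxx ?andbF.
Qed.

Lemma push_XSZE xs :
  push (with_bits sh l mu) XSZE (xs, (z, e)) =
  Pr mu (evZE z e) *
  push (tens (push (tens cond_R (@unif R (sh.-tuple bool)))
                (padded D (fun r => U (r, z) (1 - epsh))))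
             (@unif R (l.-tuple bool)))
    (fun w => (ext Ext sh sigma epsx w.1 w.2, w.2)) xs.
Proof.
set pad := padded _ _; set out := fun w => _.
pose f := tens (tens cond_R (@unif R (sh.-tuple bool)))
            (@unif R (l.-tuple bool)).
have -> : push (tens (push (tens cond_R (@unif R _)) pad) (@unif R _)) out xs =
    push f (fun v => out (pad v.1, v.2)) xs.
  rewrite -(push_comp f (fun v => (pad v.1, id v.2)) out).
  apply: eq_push => // -[x s]; rewrite [RHS](push_tens _ _ pad id) /tens /=.
  by congr (_ * _); rewrite push_id.
rewrite mulr_sumr /push.
(* Samples with Z = z and E = e are triples (r, b, s). Bank and seed change places, as the banked
   bits enter the source and the seed goes to the extractor. *)
rewrite (reindex_onto
  (fun v : RT * sh.-tuple bool * l.-tuple bool =>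
    ((((v.1.1, z), e), v.2), v.1.2) : sample RT ZT ET sh l)
  (fun w : sample RT ZT ET sh l => ((rvR (trial w), bank w), seed w))) /=.
  apply: eq_big => [[[r b] s]|[[r b] s] _] /=.
    by rewrite !xpair_eqE /= !eqxx !andbT.
  by rewrite /f /tens /=; field; rewrite gt_eqF.
case=> [[[[r z'] e'] s] b]; rewrite /XSZE /ZE /rvZ /rvE !xpair_eqE /=.
by move=> /andP[_ /andP[/eqP -> /eqP ->]].
Qed.

End Slice.

Lemma slice_bound mu z e (f : n.-tuple bool * RT -> R) q : H mu ->
  0 < Pr mu (evZE z e) ->
  (forall rz, 0 <= U rz (1 - epsh)) ->
  (forall x, 0 <= f x) ->
  (forall x, f x <= cond_law mu (rvDR D) (evZE z e) x) ->
  (forall r d, 0 <= q r d) -> (forall d, \sum_r q r d = 1) ->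
  (forall d r, f (d, r) <= U (r, z) (1 - epsh) * q r d) ->
  TV (fun xs => push (with_bits sh l mu) XSZE (xs, (z, e)))
     (fun xs => tens unifXS (push mu ZE) (xs, (z, e))) <=
  Pr mu (evZE z e) * (1 - weight f + epsx).
Proof.
move=> Hmu m_gt0 U0 f0 fle q0 q1 fq.
pose g r := f (D r, r).
(* Off the graph of [D], [f] is squeezed between 0 and a vanishing conditional law. *)
have -> : weight f = weight g.
  transitivity (\sum_d \sum_r f (d, r)).
    by rewrite pair_bigA; apply: eq_bigr => -[].
  rewrite exchange_big.
  apply: eq_bigr => r _; rewrite (bigD1 (D r)) //= big1 ?addr0 // => d Dd.
  apply: le_anti; rewrite f0 andbT; apply: le_trans (fle _) _.
  by rewrite (cond_law_DR m_gt0) eq_sym (negbTE Dd).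
have gle r : g r <= cond_R m_gt0 r.
  by apply: le_trans (fle _) _; rewrite (cond_law_DR m_gt0) eqxx.
rewrite (eq_TV (push_XSZE m_gt0)
  (g' := fun xs => Pr mu (evZE z e) * unifXS xs)); last first.
  by move=> xs; rewrite /tens /= push_ZE mulrC.
rewrite (TV_scale _ _ (ltW m_gt0)); apply: (ler_wpM2l (ltW m_gt0)).
apply: (padded_extraction (fun r => U0 (r, z)) q0 q1 (fun r => f0 _) gle
  (fun r => fq _ _) _ Hadm).
move=> r rho_gt0; apply: (Hpad Hmu (t := ((r, z), e))).
by move: rho_gt0; rewrite /= pmulr_lgt0 // invr_gt0.
Qed.

(** Covers the pairs z, e on which the soft UPE imposes nothing: both laws vanish there. *)
Lemma null_slice mu z e : Pr mu (evZE z e) = 0 ->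
  TV (fun xs => push (with_bits sh l mu) XSZE (xs, (z, e)))
     (fun xs => tens unifXS (push mu ZE) (xs, (z, e))) = 0.
Proof.
move=> m0; rewrite /TV big1 ?mulr0 // => xs _; apply/eqP.
rewrite normr_eq0 /tens /= push_ZE m0 mulr0 subr0.
rewrite /push big1 // => -[[t s] b] /eqP[_ tz te] /=.
suff -> : mu t = 0 by rewrite !mul0r.
move/eqP: m0; rewrite psumr_eq0 => [|t' _]; last exact: pmf_ge0.
move=> /allP/(_ t); rewrite mem_index_enum => /(_ isT).
by rewrite -tz -te /evZE /= !eqxx => /eqP.
Qed.

Lemma sum_Pr_evZE (mu : fdist R (RT * ZT * ET)%type) e :
  \sum_z Pr mu (evZE z e) = Pr mu (evE e).
Proof.
rewrite [RHS](partition_big (@rvZ RT ZT ET) xpredT) //=.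
by apply: eq_bigr => z _; apply: eq_bigl => t; rewrite andbC.
Qed.

Lemma joint_bound mu : H mu ->
  TV (push (with_bits sh l mu) XSZE) (tens unifXS (push mu ZE)) <=
  epsh + epsx.
Proof.
move=> Hmu; have [epsh_le1|epsh_gt1] := leP epsh 1; last first.
  apply: le_trans (TV_le1 _ _ _ _) _.
  - by rewrite weight_push; exact: pmf_sum1.
  - rewrite weight_tens weight_push [weight mu]pmf_sum1 mulr1.
    exact: unif_sum1 ([tuple of nseq _ false], [tuple of nseq _ false]).
  - by move=> x; apply: push_ge0; exact: pmf_ge0.
  - move=> x; rewrite mulr_ge0 ?invr_ge0 ?ler0n //.
    by apply: push_ge0; exact: pmf_ge0.
  by rewrite (le_trans (ltW epsh_gt1)) // lerDl ltW.
rewrite TV_slices.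
(* The error budget is shared among the values e in proportion to their probabilities, because the
   soft UPE guarantee is given for each e separately. *)
have -> : epsh + epsx = \sum_e Pr mu (evE e) * (epsh + epsx).
  have -> : \sum_e Pr mu (evE e) * (epsh + epsx) =
      (\sum_e push mu (@rvE RT ZT ET) e) * (epsh + epsx) by rewrite mulr_suml.
  by rewrite [X in X * _]weight_push [X in X * _]pmf_sum1 mul1r.
apply: ler_sum => e _.
have Pr_ge0 (A : pred (RT * ZT * ET)) : 0 <= Pr mu A.
  by apply: sumr_ge0 => t _; exact: pmf_ge0.
have m_le z : Pr mu (evZE z e) <= Pr mu (evE e).
  by rewrite -sum_Pr_evZE (bigD1 z) //= lerDl sumr_ge0.
have [e0|e_neq0] := eqVneq (Pr mu (evE e)) 0.
  rewrite e0 mul0r big1 // => z _; apply: null_slice.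
  by apply: le_anti; rewrite Pr_ge0 andbT -e0.
have e_gt0 : 0 < Pr mu (evE e) by rewrite lt_def e_neq0 Pr_ge0.
have [U0 /(_ mu e Hmu e_gt0)] : is_soft_UPE_at D epsh H (fun rz => U rz (1 - epsh)).
  by apply: HU.2; rewrite ltW.
move=> [f [fP [w_ge [q [q0 [q1 fq]]]]]].
apply: (@le_trans _ _
  (\sum_z Pr mu (evZE z e) * (1 - weight (f z) + epsx))).
  apply: ler_sum => z _; have [m0|m_neq0] := eqVneq (Pr mu (evZE z e)) 0.
    by rewrite null_slice // m0 mul0r.
  have m_gt0 : 0 < Pr mu (evZE z e) by rewrite lt_def m_neq0 Pr_ge0.
  have [[f0 _] fle] := fP _ m_gt0.
  by apply: (slice_bound (q := fun r d => q r d z)) => // d r; exact: fq.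
(* Factoring Pr(z, e) as Pr(e) Pr(z|e) exposes the average weight, which is at least 1 - epsh. *)
have -> : \sum_z Pr mu (evZE z e) * (1 - weight (f z) + epsx) =
    Pr mu (evE e) * (1 + epsx - \sum_z weight (f z) *
      cond_law mu (@rvZ RT ZT ET) (evE e) z).
  rewrite mulrBr -{1}sum_Pr_evZE mulr_suml mulr_sumr -sumrB.
  apply: eq_bigr => z _.
  rewrite [cond_law _ _ _ _](_ : _ = Pr mu (evZE z e) / Pr mu (evE e)) //.
  by field.
by rewrite ler_wpM2l //; lra.
Qed.

End Joint.

(** * From the joint law to soundness *)

(** Success is certain, so conditioning on it changes nothing; the law of [E'] itself serves as the
    ideal distribution. *)
Lemma sound_protocol (R : realType) (RT ZT ET TS TE : finType) sigma sh l
    (eps : R) (M : set (fdist R (sample RT ZT ET sh l)))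
    (PX : sample RT ZT ET sh l -> sigma.-tuple bool)
    (PS : sample RT ZT ET sh l -> TS) (E' : sample RT ZT ET sh l -> TE) :
  (forall mu, M mu ->
    TV (push mu (fun w => (PX w, PS w, E' w)))
       (tens (tens (@unif R (sigma.-tuple bool)) (push mu PS)) (push mu E'))
    <= eps) ->
  sound eps M PX PS protocol_P E'.
Proof.
move=> bound mu Mmu; exists (push_fdist mu E').
have -> : Pr mu protocol_P = 1 by rewrite -[RHS](pmf_sum1 mu).
rewrite mulr1; apply: le_trans (bound mu Mmu).
rewrite le_eqVlt; apply/orP; left; apply/eqP; apply: eq_TV => // x.
rewrite /cond_law; have -> : Pr mu protocol_P = 1 by rewrite -[RHS](pmf_sum1 mu).
by rewrite divr1; apply: eq_bigl => w /=; rewrite andbT.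
Qed.

(** Discards the banked bits, for computing the law of [protocol_S]. *)
Lemma push_seed_trial (R : realType) (RT ZT ET T : finType) sh l
    (mu : fdist R (RT * ZT * ET)%type)
    (g : (RT * ZT * ET) * l.-tuple bool -> T) :
  push (with_bits sh l mu) (fun w => g (trial w, seed w)) =1
  push (tens mu (@unif R (l.-tuple bool))) g.
Proof.
move=> x; have u1 := @unif_bits_sum1 R sh.
have := push_comp (with_bits sh l mu) fst g x.
rewrite (eq_push (push_fst (tens mu (@unif R (l.-tuple bool))) u1) (fun=> erefl)).
by move=> ->; apply: eq_push => // -[[]].
Qed.

Lemma push_trial (R : realType) (RT ZT ET T : finType) sh l
    (mu : fdist R (RT * ZT * ET)%type) (g : RT * ZT * ET -> T) :
  push (with_bits sh l mu) (fun w => g (trial w)) =1 push mu g.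
Proof.
move=> x; rewrite (push_seed_trial sh mu (fun v => g v.1)) -(push_comp _ fst).
by apply: eq_push => // t; apply: push_fst; exact: unif_bits_sum1.
Qed.

Theorem theorem20 (R : realType) (RT ZT ET : finType)
    (H : set (fdist R (RT * ZT * ET)%type))
    (n nz : nat) (D : RT -> n.-tuple bool)
    (encZ : ZT -> nz.-bseq bool) (encZ_inj : injective encZ)
    (U : RT * ZT -> R -> R) (HU : is_soft_UPE D H U)
    (sigma : nat) (sigma_gt0 : (0 < sigma)%N) (eps : R) (eps_gt0 : 0 < eps)
    (Ext : strong_extractor R)
    (sh l : nat) (epsh epsx : R)
    (sh_gt0 : (0 < sh)%N) (epsh_gt0 : 0 < epsh) (epsx_gt0 : 0 < epsx)
    (Hadm : ext_adm Ext (n + sh) l sh sigma epsx)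
    (Heps : epsh + epsx = eps)
    (Hpad : padding_ok H U sh epsh) :
  let M := protocol_model H sh l in
  let PX := protocol_X D U Ext sigma sh l epsh epsx in
  let PS := protocol_S H encZ sh l in
  (known_independent_Z H -> sound eps M PX PS protocol_P protocol_E) /\
  (~ known_independent_Z H -> sound eps M PX PS protocol_P protocol_ZE) /\
  complete M protocol_P.
Proof.
move=> M PX PS; have bound := joint_bound HU epsh_gt0 epsx_gt0 Hadm Hpad.
split; [move=> known|split; [move=> unknown|]]; last first.
- by move=> mu _; rewrite -[RHS](pmf_sum1 mu).
- apply: sound_protocol => _ [mu Hmu ->]; rewrite -Heps.
  (* Here z' is empty, so [PS] is a function of the seed alone and Z stays in the side
     information. *)
  pose g (s : l.-tuple bool) : (nz + l).-bseq bool :=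
    [bseq of ([bseq] : nz.-bseq bool) ++ bseq_of_tuple s].
  have PSE w : PS w = g (seed w).
    by apply: val_inj; rewrite /PS /protocol_S /protocol_z' /= asboolF.
  pose G (v : (sigma.-tuple bool * l.-tuple bool) * (ZT * ET)) :=
    (v.1.1, g v.1.2, v.2).
  apply: le_trans (bound _ Hmu); apply: le_trans (TV_push _ _ G).
  rewrite le_eqVlt; apply/orP; left; apply/eqP; apply: eq_TV => [x|x].
    by rewrite push_comp; apply: eq_push => // w; rewrite PSE.
  rewrite (eq_push (f := tens (@unif R _) _)
    (g := tens (tens (@unif R _) (@unif R _)) (push mu (@ZE RT ZT ET)))
    (Y := fun v => ((v.1.1, g v.1.2), v.2))) //; last first.
    by case=> xs ze; rewrite /tens unif_tens.
  rewrite (push_tens _ _ (fun p => (id p.1, g p.2)) id) !tensE.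
  rewrite (push_tens _ _ id g) tensE !push_id.
  rewrite -(push_trial sh l mu (@ZE RT ZT ET)); congr (_ * _ * _).
  rewrite (eq_push (fun=> erefl) PSE).
  rewrite (push_seed_trial sh mu (fun v => g v.2)) -(push_comp _ snd).
  by apply: eq_push => // s; apply: push_snd; exact: pmf_sum1.
- apply: sound_protocol => _ [mu Hmu ->]; rewrite -Heps.
  pose g (v : ZT * l.-tuple bool) : (nz + l).-bseq bool :=
    [bseq of encZ v.1 ++ bseq_of_tuple v.2].
  have PSE w : PS w = g (rvZ (trial w), seed w).
    by apply: val_inj; rewrite /PS /protocol_S /protocol_z' /= asboolT.
  pose G (v : (sigma.-tuple bool * l.-tuple bool) * (ZT * ET)) :=
    (v.1.1, g (v.2.1, v.1.2), v.2.2).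
  (* This regrouping moves Z from the side of E to the side of the seed, so that the ideal law
     becomes a product over output, reusable string and E. *)
  pose h (v : (sigma.-tuple bool * (ZT * l.-tuple bool)) * ET) :
      (sigma.-tuple bool * l.-tuple bool) * (ZT * ET) :=
    ((v.1.1, v.1.2.2), (v.1.2.1, v.2)).
  have bij_h : bijective h.
    exists (fun v => ((v.1.1, (v.2.1, v.1.2)), v.2.2)).
      by case=> -[x [z s]] e.
    by case=> -[x s] [z e].
  apply: le_trans (bound _ Hmu); apply: le_trans (TV_push _ _ G).
  rewrite le_eqVlt; apply/orP; left; apply/eqP; apply: eq_TV => [x|x].
    by rewrite push_comp; apply: eq_push => // w; rewrite PSE.
  have [nuZ /(_ _ Hmu)[_ indep]] := known.
  rewrite (push_bij _ _ bij_h).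
  rewrite (eq_push (g := tens (tens (@unif R _)
                                 (tens (push mu (@rvZ RT ZT ET)) (@unif R _)))
                              (push mu (@rvE RT ZT ET)))
    (Y := fun v => ((v.1.1, g v.1.2), v.2))); last 2 first.
  (* Independence of Z and E splits the factor for (Z, E). *)
  + case=> [[x' [z s]] e]; rewrite /tens /= push_ZE indep unif_tens /tens /=.
    by rewrite -!mulrA (mulrCA (unif R s)) /law.
  + by case=> [[x' [z s]] e].
  rewrite (push_tens _ _ (fun p => (id p.1, g p.2)) id) !tensE.
  rewrite (push_tens _ _ id g) tensE !push_id.
  rewrite -(push_trial sh l mu (@rvE RT ZT ET)); congr (_ * _ * _).
  rewrite (eq_push (fun=> erefl) PSE).
  rewrite (push_seed_trial sh mu (fun v => g (rvZ v.1, v.2))).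
  rewrite -(push_comp _ (fun v => (rvZ v.1, id v.2))).
  apply: eq_push => // v.
  by rewrite (push_tens _ _ (@rvZ RT ZT ET) id) /tens push_id.
Qed.
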